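(* Let $f\in\mathcal{S}'(\mathbb{R})$ and suppose that its metamorphism is $\mathcal{M}f=\mathcal{G}f_2$ for some holomorphic function $f_2$ of two complex variables $(z,w)$. Then $$\mathcal{M}(f'')=\mathcal{G}(\mathcal{D}f_2),$$ where $$[\mathcal{D}f_2](z,w) = 2\pi i\hbar\, w\left(2z\,\partial_z f_2(z,w)+2w\,\partial_w f_2(z,w)+f_2(z,w)\right).$$
   Context: Fix a constant $\hbar>0$. The metamorphism of a function $f(u)$, $u\in\mathbb{R}$, is the function $\mathcal{M}f$ of $(x,y,b,r)\in\mathbb{R}\times\mathbb{R}\times\mathbb{R}\times(0,\infty)$ given by $$[\mathcal{M}f](x,y,b,r)=\sqrt{\hbar r}\int_{\mathbb{R}} f(u)\,\exp\left(-\pi\hbar\left((r^2-ib)(u-y)^2+2i(u-y)x\right)\right)\,du .$$ For $f\in\mathcal{S}'(\mathbb{R})$ the integral is understood as the (bilinear) pairing of $f$ with the integral kernel, which is a Schwartz function of $u$; $f''$ is the distributional second derivative. For a holomorphic function $f_2(z,w)$ of two complex variables $z\in\mathbb{C}$, $w\in\{w\in\mathbb{C}:\operatorname{Im} w>0\}$, the function $\mathcal{G}f_2$ on $\mathbb{R}^3\times(0,\infty)$ is $$[\mathcal{G}f_2](x,y,b,r)=\sqrt{r}\,e^{-\pi\hbar x^2/(r^2-ib)}\,f_2\left(x+(b+ir^2)y,\ b+ir^2\right)=\sqrt{r}\,e^{-\pi i\hbar x^2/w}f_2(z,w),$$ with $w=b+ir^2$ and $z=x+(b+ir^2)y=x+wy$.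 *)

(* Defs.v *)
From Stdlib Require Import Reals.
From Coquelicot Require Export Coquelicot.
Open Scope R_scope.

Definition Cexp (z : C) : C :=
  (exp (Re z) * cos (Im z), exp (Re z) * sin (Im z)).

(* k-th derivative of a complex-valued function of a real variable, taken
   componentwise; it is meaningful under [smooth]. *)
Definition RC_Derive_n (phi : R -> C) (k : nat) (u : R) : C :=
  (Derive_n (fun t => Re (phi t)) k u, Derive_n (fun t => Im (phi t)) k u).

Definition smooth (phi : R -> C) : Prop :=
  forall (k : nat) (u : R),
    ex_derive_n (fun t => Re (phi t)) k u /\
    ex_derive_n (fun t => Im (phi t)) k u.

(* sup_u |u^j phi^(k)(u)|, possibly +oo *)
Definition schwartz_seminorm (j k : nat) (phi : R -> C) : Rbar :=
  Lub_Rbar (fun s => exists u : R, s = Rabs u ^ j * Cmod (RC_Derive_n phi k u)).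

Definition schwartz (phi : R -> C) : Prop :=
  smooth phi /\ forall j k : nat, is_finite (schwartz_seminorm j k phi).

(* Neighbourhoods of phi in the locally convex topology of the Schwartz space,
   that is, the one generated by the family of all the seminorms. *)
Definition schwartz_nbhs (phi : R -> C) (P : (R -> C) -> Prop) : Prop :=
  exists (N : nat) (delta : posreal),
    forall psi : R -> C, schwartz psi ->
      (forall j k : nat, (j <= N)%nat -> (k <= N)%nat ->
        Rbar_lt (schwartz_seminorm j k (fun u => psi u - phi u)%C) delta) ->
      P psi.

(* A tempered distribution is represented by a function on all of [R -> C], of
   which only the values on Schwartz functions (where it has to be linear and
   continuous) matter.  [T phi] is the bilinear pairing of T with phi: linear,
   not conjugate-linear, in phi. *)
Definition tempered_distribution (T : (R -> C) -> C) : Prop :=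
  (forall (a b : C) (phi psi : R -> C), schwartz phi -> schwartz psi ->
    T (fun u => a * phi u + b * psi u)%C = (a * T phi + b * T psi)%C) /\
  (forall phi : R -> C, schwartz phi ->
    filterlim T (schwartz_nbhs phi) (@locally C_UniformSpace (T phi))).

Definition distr_derive (T : (R -> C) -> C) : (R -> C) -> C :=
  fun phi => (- T (RC_Derive_n phi 1))%C.

Definition metamorphism_kernel (hbar x y b r u : R) : C :=
  Cexp (- (PI * hbar) *
        ((r ^ 2 - Ci * b) * (u - y) ^ 2 + 2 * Ci * (u - y) * x))%C.

(* The kernel is a Schwartz function of u when hbar > 0 and r > 0. *)
Definition metamorphism (hbar : R) (T : (R -> C) -> C) (x y b r : R) : C :=
  (sqrt (hbar * r)%R * T (metamorphism_kernel hbar x y b r))%C.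

(* Complex (Frechet) differentiability at every point of C x {Im w > 0}; the
   values of f2 outside of this open set are irrelevant. *)
Definition holomorphic_on_C_H (f2 : C -> C -> C) : Prop :=
  forall z w : C, 0 < Im w ->
    @ex_filterdiff C_AbsRing
      (prod_NormedModule C_AbsRing C_NormedModule C_NormedModule) C_NormedModule
      (fun p => f2 (fst p) (snd p))
      (@locally (prod_UniformSpace C_UniformSpace C_UniformSpace) (z, w)).

Definition G_map (hbar : R) (f2 : C -> C -> C) (x y b r : R) : C :=
  (sqrt r * Cexp (- (PI * hbar * x ^ 2) / (r ^ 2 - Ci * b)) *
   f2 (x + (b + Ci * r ^ 2) * y) (b + Ci * r ^ 2))%C.

Definition D_op (hbar : R) (f2 : C -> C -> C) (z w : C) : C :=
  (2 * PI * Ci * hbar * w *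
   (2 * z * C_derive (fun z' => f2 z' w) z +
    2 * w * C_derive (fun w' => f2 z w') w +
    f2 z w))%C.

(* Main.v *)
Require Import Defs.
From Stdlib Require Import Reals Lra Lia FunctionalExtensionality.
From Coquelicot Require Import Coquelicot.

(** The dilation [(z, w) -> ((1 + t) z, (1 + t) w)], with [t] real, turns the
    claim into one derivative in one real parameter.

    Put w = b + i r^2 and z = x + w y.  The exponent of the kernel is
    kappa + A(u), where kappa = - pi i hbar x^2 / w and
    A(u) = pi i hbar (w u - z)^2 / w.  Hence M f = G f2 says exactly that
    f2(z, w) = sqrt(hbar) <f, exp A> ([holomorphic_part_pairing]).  Since A is
    homogeneous of degree one in (z, w), the dilation replaces A by (1 + t) A, and
    differentiating at t = 0 gives
    z d_z f2 + w d_w f2 = sqrt(hbar) <f, A exp A> ([holomorphic_part_radial]).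

    On the other side, A is a multiple of a square, so A'^2 = 4 c A and A'' = 2 c
    with c = pi i hbar w, and therefore (exp A)'' = 2 c (exp A + 2 A exp A)
    ([gauss_second_derivative]).  Pairing with f, and moving the two derivatives
    from f to the kernel, gives 2 c (2 z d_z + 2 w d_w + 1) f2, which is D f2.

    The radial derivative of f2 is read off in two ways.  Holomorphy in two
    variables gives it as z d_z f2 + w d_w f2 ([holomorphic_radial]).
    Continuity of f gives it as the pairing, once the quotients
    (exp ((1 + t) A) - exp A) / t are known to converge to A exp A in the Schwartz
    space as t decreases to 0 ([tempered_gauss_dilation]).  For this convergence
    the difference is written as t times the second divided difference
    [gauss_diff2].  The functions exp A and its first and second divided
    differences in t generate, over polynomials in t and u, a family that is
    closed under d/du ([fam_derive]) and rapidly decreasing uniformly in t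
    ([gauss_family_bounded]); so every seminorm of the difference is O(t). *)

(** * Complex-valued functions of a real variable *)

Definition is_RC_derive (phi : R -> C) (u : R) (l : C) : Prop :=
  is_derive (fun t => Re (phi t)) u (Re l) /\
  is_derive (fun t => Im (phi t)) u (Im l).

Lemma is_RC_derive_const (c : C) (u : R) : is_RC_derive (fun _ => c) u 0.
Proof. split; apply @is_derive_const. Qed.

Lemma is_RC_derive_id (u : R) : is_RC_derive (fun t => RtoC t) u 1.
Proof. split; [apply @is_derive_id | exact (is_derive_const (K := R_AbsRing) 0 u)]. Qed.

Lemma is_RC_derive_plus (phi psi : R -> C) (u : R) (l m : C) :
  is_RC_derive phi u l -> is_RC_derive psi u m ->
  is_RC_derive (fun t => phi t + psi t)%C u (l + m)%C.
Proof.
  intros [H1 H2] [H3 H4].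
  split; [apply (is_derive_plus _ _ _ _ _ H1 H3) | apply (is_derive_plus _ _ _ _ _ H2 H4)].
Qed.

Lemma is_RC_derive_mult (phi psi : R -> C) (u : R) (l m : C) :
  is_RC_derive phi u l -> is_RC_derive psi u m ->
  is_RC_derive (fun t => phi t * psi t)%C u (l * psi u + phi u * m)%C.
Proof.
  intros [H1 H2] [H3 H4].
  assert (prod : forall (g h : R -> R) (g' h' : R), is_derive g u g' -> is_derive h u h' ->
    is_derive (fun t => g t * h t) u (g' * h u + g u * h')).
  { intros g h g' h' Hg Hh. exact (is_derive_mult g h u g' h' Hg Hh Rmult_comm). }
  split.
  - replace (Re _) with ((Re l * Re (psi u) + Re (phi u) * Re m)
      - (Im l * Im (psi u) + Im (phi u) * Im m)) by (unfold Re, Im; simpl; ring).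
    exact (is_derive_minus _ _ _ _ _ (prod _ _ _ _ H1 H3) (prod _ _ _ _ H2 H4)).
  - replace (Im _) with ((Re l * Im (psi u) + Re (phi u) * Im m)
      + (Im l * Re (psi u) + Im (phi u) * Re m)) by (unfold Re, Im; simpl; ring).
    exact (is_derive_plus _ _ _ _ _ (prod _ _ _ _ H1 H4) (prod _ _ _ _ H2 H3)).
Qed.

Lemma is_RC_derive_scal (c : C) (phi : R -> C) (u : R) (l : C) :
  is_RC_derive phi u l -> is_RC_derive (fun t => c * phi t)%C u (c * l)%C.
Proof.
  intros H.
  replace (c * l)%C with (0 * phi u + c * l)%C by ring.
  apply (is_RC_derive_mult (fun _ => c)); [apply is_RC_derive_const | exact H].
Qed.

Lemma is_RC_derive_Cexp (phi : R -> C) (u : R) (l : C) :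
  is_RC_derive phi u l ->
  is_RC_derive (fun t => Cexp (phi t)) u (l * Cexp (phi u))%C.
Proof.
  intros [H1 H2].
  assert (DE := is_derive_comp exp _ u _ _ (is_derive_exp _) H1).
  assert (DC := is_derive_comp cos _ u _ _ (is_derive_cos _) H2).
  assert (DS := is_derive_comp sin _ u _ _ (is_derive_sin _) H2).
  split.
  - replace (Re _) with
      (Re l * exp (Re (phi u)) * cos (Im (phi u))
       + exp (Re (phi u)) * (Im l * - sin (Im (phi u))))
      by (unfold Cexp, Re, Im; simpl; ring).
    exact (is_derive_mult _ _ u _ _ DE DC Rmult_comm).
  - replace (Im _) with
      (Re l * exp (Re (phi u)) * sin (Im (phi u))
       + exp (Re (phi u)) * (Im l * cos (Im (phi u))))
      by (unfold Cexp, Re, Im; simpl; ring).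
    exact (is_derive_mult _ _ u _ _ DE DS Rmult_comm).
Qed.

Lemma RC_Derive_n_1 (phi : R -> C) (u : R) (l : C) :
  is_RC_derive phi u l -> RC_Derive_n phi 1 u = l.
Proof.
  intros [H1 H2].
  apply injective_projections; apply is_derive_unique; assumption.
Qed.

Lemma exp_le_mono (x y : R) : x <= y -> exp x <= exp y.
Proof.
  intros [H| ->]; [left; apply exp_increasing, H | apply Rle_refl].
Qed.

Lemma sqrt2_le_2 : sqrt 2 <= 2.
Proof. rewrite <- (sqrt_square 2) at 2 by lra. apply sqrt_le_1; lra. Qed.

Lemma Cexp_plus (z w : C) : Cexp (z + w)%C = (Cexp z * Cexp w)%C.
Proof.
  unfold Cexp. destruct z as [a b], w as [c d]; simpl.
  unfold Cmult; simpl. rewrite exp_plus, cos_plus, sin_plus.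
  apply injective_projections; simpl; ring.
Qed.

Lemma Cmod_Cexp (z : C) : Cmod (Cexp z) = exp (Re z).
Proof.
  unfold Cmod, Cexp; simpl.
  replace (_ + _) with (exp (Re z) * exp (Re z)).
  - apply sqrt_square. left; apply exp_pos.
  - generalize (sin2_cos2 (Im z)); unfold Rsqr; intros H.
    transitivity (exp (Re z) * exp (Re z) * (sin (Im z) * sin (Im z) + cos (Im z) * cos (Im z)));
      [rewrite H; ring | ring].
Qed.

(** There is no intermediate-point theorem for complex values; the real one is
    used on each component, whence the factor 2 (any constant would do). *)
Lemma Cmod_mean_value (phi dphi : R -> C) (t M : R) :
  0 < t ->
  (forall s, 0 <= s <= t -> is_RC_derive phi s (dphi s)) ->
  (forall s, 0 <= s <= t -> Cmod (dphi s) <= M) ->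
  Cmod (phi t - phi 0)%C <= 2 * M * t.
Proof.
  intros Ht Hd HM.
  assert (part : forall g dg : R -> R,
    (forall s, 0 <= s <= t -> is_derive g s (dg s)) ->
    (forall s, 0 <= s <= t -> Rabs (dg s) <= M) -> Rabs (g t - g 0) <= M * t).
  { intros g dg Hg Hb.
    destruct (MVT_gen g 0 t dg) as [c [Hc He]].
    - rewrite Rmin_left, Rmax_right by lra. intros s Hs; apply Hg; lra.
    - rewrite Rmin_left, Rmax_right by lra. intros s Hs.
      apply continuity_pt_filterlim, @ex_derive_continuous.
      eexists; apply Hg; lra.
    - rewrite Rmin_left, Rmax_right in Hc by lra.
      rewrite He, Rabs_mult, (Rabs_right (t - 0)) by lra.
      specialize (Hb c Hc). nra. }
  assert (HR : Rabs (Re (phi t) - Re (phi 0)) <= M * t).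
  { apply (part (fun s => Re (phi s)) (fun s => Re (dphi s))).
    - intros s Hs; apply Hd; exact Hs.
    - intros s Hs. eapply Rle_trans; [apply re_le_Cmod | apply HM, Hs]. }
  assert (HI : Rabs (Im (phi t) - Im (phi 0)) <= M * t).
  { apply (part (fun s => Im (phi s)) (fun s => Im (dphi s))).
    - intros s Hs; apply Hd; exact Hs.
    - intros s Hs. eapply Rle_trans; [|apply HM, Hs].
      eapply Rle_trans; [apply Rmax_r | apply Rmax_Cmod]. }
  eapply Rle_trans; [apply Cmod_2Rmax|].
  assert (Rmax (Rabs (fst (phi t - phi 0)%C)) (Rabs (snd (phi t - phi 0)%C)) <= M * t)
    by (apply Rmax_lub; assumption).
  assert (Hs2 := sqrt2_le_2).
  assert (0 <= Rmax (Rabs (fst (phi t - phi 0)%C)) (Rabs (snd (phi t - phi 0)%C))).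
  { eapply Rle_trans; [apply Rabs_pos | apply Rmax_l]. }
  assert (0 <= sqrt 2) by apply sqrt_pos.
  nra.
Qed.

(** * The Gaussian family *)

Definition quad (a b c : C) (u : R) : C := (a + b * u + c * (u * u))%C.

Definition gauss (a b c : C) (u : R) : C := Cexp (quad a b c u).

(** First and second divided differences at [0], in the parameter [s], of
    [exp ((1 + s) quad)]; both have finite limits as [t] tends to [0]. *)
Definition gauss_diff1 (a b c : C) (t u : R) : C :=
  (/ t * (Cexp ((1 + t) * quad a b c u) - gauss a b c u))%C.

Definition gauss_diff2 (a b c : C) (t u : R) : C :=
  (/ t * (gauss_diff1 a b c t u - quad a b c u * gauss a b c u))%C.

(** The span over polynomials in [t] and [u] of the exponential and its two
    divided differences.  It is given by generation so that closure under
    differentiation and the uniform bounds are one induction each. *)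
Inductive gauss_family (a b c : C) : (R -> R -> C) -> Prop :=
| fam_gauss : gauss_family a b c (fun _ u => gauss a b c u)
| fam_diff1 : gauss_family a b c (gauss_diff1 a b c)
| fam_diff2 : gauss_family a b c (gauss_diff2 a b c)
| fam_plus F G : gauss_family a b c F -> gauss_family a b c G ->
    gauss_family a b c (fun t u => F t u + G t u)%C
| fam_scal k F : gauss_family a b c F ->
    gauss_family a b c (fun t u => k * F t u)%C
| fam_param F : gauss_family a b c F ->
    gauss_family a b c (fun t u => RtoC t * F t u)%C
| fam_var F : gauss_family a b c F ->
    gauss_family a b c (fun t u => RtoC u * F t u)%C.

Lemma RtoC_neq_0 (t : R) : t <> 0 -> RtoC t <> 0%C.
Proof. intros Ht He; apply Ht, (RtoC_inj _ _ He). Qed.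

Lemma is_RC_derive_quad (a b c : C) (u : R) :
  is_RC_derive (quad a b c) u (b + 2 * c * u)%C.
Proof.
  replace (b + 2 * c * u)%C with (0 + b * 1 + c * (1 * u + u * 1))%C by ring.
  apply is_RC_derive_plus; [apply is_RC_derive_plus|].
  - apply is_RC_derive_const.
  - apply is_RC_derive_scal, is_RC_derive_id.
  - apply is_RC_derive_scal, is_RC_derive_mult; apply is_RC_derive_id.
Qed.

Lemma is_RC_derive_gauss (a b c : C) (u : R) :
  is_RC_derive (gauss a b c) u ((b + 2 * c * u) * gauss a b c u)%C.
Proof. apply is_RC_derive_Cexp, is_RC_derive_quad. Qed.

Lemma is_RC_derive_gauss_diff1 (a b c : C) (t u : R) : t <> 0 ->
  is_RC_derive (gauss_diff1 a b c t) u
    ((b + 2 * c * u) * ((1 + t) * gauss_diff1 a b c t u + gauss a b c u))%C.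
Proof.
  intros Ht. assert (Ht' := RtoC_neq_0 t Ht).
  replace ((b + 2 * c * u) * ((1 + t) * gauss_diff1 a b c t u + gauss a b c u))%C
    with (/ t * (((1 + t) * (b + 2 * c * u)) * Cexp ((1 + t) * quad a b c u)
          + (- (1)) * ((b + 2 * c * u) * gauss a b c u)))%C
    by (unfold gauss_diff1; field; exact Ht').
  replace (gauss_diff1 a b c t) with
    (fun u => / t * (Cexp ((1 + t) * quad a b c u) + (- (1)) * gauss a b c u))%C
    by (apply functional_extensionality; intros v; unfold gauss_diff1; ring).
  apply is_RC_derive_scal, is_RC_derive_plus.
  - apply is_RC_derive_Cexp, is_RC_derive_scal, is_RC_derive_quad.
  - apply is_RC_derive_scal, is_RC_derive_gauss.
Qed.

Lemma is_RC_derive_gauss_diff2 (a b c : C) (t u : R) : t <> 0 ->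
  is_RC_derive (gauss_diff2 a b c t) u
    ((b + 2 * c * u) * (gauss_diff2 a b c t u + gauss_diff1 a b c t u))%C.
Proof.
  intros Ht. assert (Ht' := RtoC_neq_0 t Ht).
  replace ((b + 2 * c * u) * (gauss_diff2 a b c t u + gauss_diff1 a b c t u))%C
    with (/ t * ((b + 2 * c * u) * ((1 + t) * gauss_diff1 a b c t u + gauss a b c u)
       + (- (1)) * ((b + 2 * c * u) * gauss a b c u
            + quad a b c u * ((b + 2 * c * u) * gauss a b c u))))%C
    by (unfold gauss_diff2; field; exact Ht').
  replace (gauss_diff2 a b c t) with
    (fun u => / t * (gauss_diff1 a b c t u + (- (1)) * (quad a b c u * gauss a b c u)))%C
    by (apply functional_extensionality; intros v; unfold gauss_diff2; ring).
  apply is_RC_derive_scal, is_RC_derive_plus.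
  - apply is_RC_derive_gauss_diff1, Ht.
  - apply is_RC_derive_scal, is_RC_derive_mult;
      [apply is_RC_derive_quad | apply is_RC_derive_gauss].
Qed.

Lemma fam_ext (a b c : C) (F G : R -> R -> C) :
  (forall t u, F t u = G t u) -> gauss_family a b c F -> gauss_family a b c G.
Proof.
  intros H HF. replace G with F; [exact HF|].
  apply functional_extensionality; intros t.
  apply functional_extensionality; intros u. apply H.
Qed.

Lemma fam_linear (a b c k m : C) (F : R -> R -> C) :
  gauss_family a b c F -> gauss_family a b c (fun t u => (k + m * u) * F t u)%C.
Proof.
  intros HF.
  apply (fam_ext _ _ _ (fun t u => k * F t u + m * (RtoC u * F t u))%C).
  - intros; ring.
  - apply fam_plus; apply fam_scal; [|apply fam_var]; exact HF.
Qed.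

(** The derivative of each divided difference is a combination, with coefficients
    polynomial in [t] and [u] and no division by [t], of itself and the lower
    ones; this is why the three generators suffice. *)
Lemma fam_derive (a b c : C) (F : R -> R -> C) : gauss_family a b c F ->
  exists dF, gauss_family a b c dF /\
    forall t u, t <> 0 -> is_RC_derive (F t) u (dF t u).
Proof.
  intros HF; induction HF as
    [ | | | F G _ [dF [HdF IF]] _ [dG [HdG IG]] | k F _ [dF [HdF IF]]
    | F _ [dF [HdF IF]] | F HF [dF [HdF IF]] ].
  - eexists; split; [|intros t u _; apply is_RC_derive_gauss].
    apply (fam_linear a b c b (2 * c)%C (fun _ u => gauss a b c u)), fam_gauss.
  - eexists; split; [|apply is_RC_derive_gauss_diff1].
    apply (fam_linear a b c b (2 * c)%C (fun t u => (1 + t) * gauss_diff1 a b c t u + gauss a b c u)%C).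
    apply fam_plus; [|apply fam_gauss].
    apply (fam_ext _ _ _ (fun t u => 1 * gauss_diff1 a b c t u + t * gauss_diff1 a b c t u)%C);
      [intros; ring|].
    apply fam_plus; [apply fam_scal | apply fam_param]; apply fam_diff1.
  - eexists; split; [|apply is_RC_derive_gauss_diff2].
    apply (fam_linear a b c b (2 * c)%C (fun t u => gauss_diff2 a b c t u + gauss_diff1 a b c t u)%C).
    apply fam_plus; [apply fam_diff2 | apply fam_diff1].
  - exists (fun t u => dF t u + dG t u)%C; split; [apply fam_plus; assumption|].
    intros t u Ht; apply is_RC_derive_plus; auto.
  - exists (fun t u => k * dF t u)%C; split; [apply fam_scal; assumption|].
    intros t u Ht; apply is_RC_derive_scal; auto.
  - exists (fun t u : R => t * dF t u)%C; split; [apply fam_param; assumption|].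
    intros t u Ht; apply is_RC_derive_scal; auto.
  - exists (fun t u : R => 1 * F t u + u * dF t u)%C; split.
    + apply fam_plus; [apply fam_scal | apply fam_var]; assumption.
    + intros t u Ht; apply is_RC_derive_mult; [apply is_RC_derive_id | auto].
Qed.

Lemma fam_Derive_n (a b c : C) (F : R -> R -> C) (k : nat) :
  gauss_family a b c F ->
  exists dF, gauss_family a b c dF /\ forall t, t <> 0 ->
    RC_Derive_n (F t) k = dF t /\
    forall u, ex_derive_n (fun s => Re (F t s)) k u /\
              ex_derive_n (fun s => Im (F t s)) k u.
Proof.
  intros HF; induction k as [|k [G [HG IG]]].
  - exists F; split; [exact HF|]. intros t _; split; [|split; exact I].
    apply functional_extensionality; intros u. symmetry; apply surjective_pairing.
  - destruct (fam_derive _ _ _ G HG) as [dG [HdG DG]].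
    exists dG; split; [exact HdG|]. intros t Ht.
    destruct (IG t Ht) as [E _].
    assert (ER : forall s, Re (G t s) = Derive_n (fun s => Re (F t s)) k s)
      by (intros s; rewrite <- E; reflexivity).
    assert (EI : forall s, Im (G t s) = Derive_n (fun s => Im (F t s)) k s)
      by (intros s; rewrite <- E; reflexivity).
    assert (D : forall u,
      is_derive (Derive_n (fun s => Re (F t s)) k) u (Re (dG t u)) /\
      is_derive (Derive_n (fun s => Im (F t s)) k) u (Im (dG t u))).
    { intros u. destruct (DG t u Ht) as [D1 D2]. split.
      - exact (is_derive_ext _ _ _ _ ER D1).
      - exact (is_derive_ext _ _ _ _ EI D2). }
    split.
    + apply functional_extensionality; intros u. destruct (D u) as [D1 D2].
      apply injective_projections; apply is_derive_unique; assumption.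
    + intros u. destruct (D u) as [D1 D2]. split; eexists; eassumption.
Qed.

(** * Gaussian bounds uniform in the parameter *)

(** Each factor [1 + u^2] is paid for by half of the remaining exponent. *)
Lemma gaussian_decay (m : nat) (c : R) : 0 < c ->
  exists B, forall u, (1 + u * u) ^ m * exp (- (c * (u * u))) <= B.
Proof.
  revert c; induction m as [|m IH]; intros c Hc.
  - exists 1. intros u. simpl. rewrite Rmult_1_l, <- exp_0.
    apply exp_le_mono. nra.
  - destruct (IH (c / 2)) as [B HB]; [lra|].
    exists (B * (1 + 2 / c)). intros u.
    assert (Hu : 0 <= u * u) by nra.
    replace (exp (- (c * (u * u)))) with
      (exp (- (c / 2 * (u * u))) * exp (- (c / 2 * (u * u))))
      by (rewrite <- exp_plus; f_equal; field).
    simpl pow.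
    assert (E : (1 + u * u) * exp (- (c / 2 * (u * u))) <= 1 + 2 / c).
    { assert (H := exp_ineq1_le (c / 2 * (u * u))).
      rewrite exp_Ropp.
      apply Rmult_le_reg_r with (exp (c / 2 * (u * u))); [apply exp_pos|].
      rewrite Rmult_assoc, Rinv_l by (apply Rgt_not_eq, exp_pos).
      assert (0 < 2 / c) by (apply Rdiv_lt_0_compat; lra).
      assert ((2 / c) * (c / 2 * (u * u)) = u * u) by (field; lra).
      assert (0 <= c / 2 * (u * u)) by nra.
      nra. }
    specialize (HB u).
    assert (0 <= (1 + u * u) ^ m * exp (- (c / 2 * (u * u)))).
    { apply Rmult_le_pos; [apply pow_le; nra | left; apply exp_pos]. }
    assert (0 <= (1 + u * u) * exp (- (c / 2 * (u * u)))).
    { apply Rmult_le_pos; [nra | left; apply exp_pos]. }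
    replace (_ * _) with (((1 + u * u) ^ m * exp (- (c / 2 * (u * u))))
      * ((1 + u * u) * exp (- (c / 2 * (u * u))))) by ring.
    apply Rmult_le_compat; assumption.
Qed.

(** Half of the negative leading coefficient absorbs the linear term, by
    completing the square. *)
Lemma Re_quad_le (a b c : C) : Re c < 0 ->
  exists M k, 0 <= M /\ 0 < k /\ forall u, Re (quad a b c u) <= M - k * (u * u).
Proof.
  intros Hc. exists (Rabs (Re a) + Re b * Re b / (- 2 * Re c)), (- Re c / 2).
  assert (0 <= Re b * Re b / (- 2 * Re c)).
  { apply Rmult_le_pos; [nra | left; apply Rinv_0_lt_compat; lra]. }
  assert (Ha := Rle_abs (Re a)). assert (Ha' := Rabs_pos (Re a)).
  repeat split; [lra | lra |].
  intros u.
  replace (Re (quad a b c u)) with (Re a + Re b * u + Re c * (u * u))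
    by (unfold quad, Re; simpl; ring).
  assert (E : Re b * Re b / (- 2 * Re c) - Re b * u + (- Re c / 2) * (u * u)
     = (- Re c / 2) * ((u + Re b / Re c) * (u + Re b / Re c))) by (field; lra).
  assert (0 <= (u + Re b / Re c) * (u + Re b / Re c)) by apply Rle_0_sqr.
  assert (0 <= (- Re c / 2) * ((u + Re b / Re c) * (u + Re b / Re c))) by (apply Rmult_le_pos; lra).
  lra.
Qed.

Lemma Cmod_quad_le (a b c : C) (u : R) :
  Cmod (quad a b c u) <= (Cmod a + Cmod b + Cmod c) * (1 + u * u).
Proof.
  unfold quad.
  eapply Rle_trans; [apply Cmod_triangle|].
  eapply Rle_trans; [apply Rplus_le_compat_r, Cmod_triangle|].
  rewrite !Cmod_mult, !Cmod_R.
  assert (Ha := Cmod_ge_0 a). assert (Hb := Cmod_ge_0 b). assert (Hc := Cmod_ge_0 c).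
  assert (Hu : Rabs u * Rabs u = u * u) by (rewrite <- Rabs_mult; apply Rabs_right; nra).
  assert (Hu' := Rabs_pos u).
  assert (Rabs u <= 1 + u * u) by nra.
  assert (0 <= u * u) by nra.
  assert (Cmod b * Rabs u <= Cmod b * (1 + u * u)) by (apply Rmult_le_compat_l; assumption).
  rewrite Hu. nra.
Qed.

(** One Gaussian dominates the whole segment of dilated exponents: for
    [0 <= s <= 1] the factor [1 + s] at most doubles the constant [M] and only
    increases the decay. *)
Lemma Cmod_gauss_dilation_le (a b c : C) : Re c < 0 ->
  exists M k, 0 < k /\ forall s u, 0 <= s <= 1 ->
    Cmod (Cexp ((1 + s) * quad a b c u)) <= exp (M - k * (u * u)).
Proof.
  intros Hc. destruct (Re_quad_le a b c Hc) as [M [k [HM [Hk HA]]]].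
  exists (2 * M), k. split; [exact Hk|]. intros s u Hs. rewrite Cmod_Cexp.
  replace (Re ((1 + s) * quad a b c u)%C) with ((1 + s) * Re (quad a b c u))
    by (unfold Re, Im; simpl; ring).
  specialize (HA u).
  assert (0 <= k * (u * u)) by (apply Rmult_le_pos; nra).
  apply exp_le_mono. nra.
Qed.

Lemma quad_dilation_0 (a b c : C) (u : R) :
  ((1 + 0) * quad a b c u)%C = quad a b c u.
Proof. ring. Qed.

Lemma is_RC_derive_Cexp_param (q : C) (s : R) :
  is_RC_derive (fun s => Cexp ((1 + s) * q))%C s (q * Cexp ((1 + s) * q))%C.
Proof.
  apply is_RC_derive_Cexp.
  assert (H : is_RC_derive (fun s => (1 + s) * q)%C s ((0 + 1) * q + (1 + s) * 0)%C).
  { apply (is_RC_derive_mult (fun s => 1 + RtoC s)%C (fun _ => q));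
      [|apply is_RC_derive_const].
    apply is_RC_derive_plus; [apply is_RC_derive_const | apply is_RC_derive_id]. }
  replace ((0 + 1) * q + (1 + s) * 0)%C with q in H by ring.
  exact H.
Qed.

Lemma Cmod_gauss_increment_le (a b c : C) (u E t : R) :
  (forall s, 0 <= s <= 1 -> Cmod (Cexp ((1 + s) * quad a b c u)) <= E) ->
  0 < t <= 1 ->
  Cmod (Cexp ((1 + t) * quad a b c u) - gauss a b c u)%C
  <= 2 * (Cmod (quad a b c u) * E) * t.
Proof.
  intros HE Ht.
  replace (gauss a b c u) with (Cexp ((1 + 0) * quad a b c u))%C
    by (unfold gauss; f_equal; ring).
  apply (Cmod_mean_value (fun s => Cexp ((1 + s) * quad a b c u))
           (fun s => quad a b c u * Cexp ((1 + s) * quad a b c u))%C); [lra| |].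
  - intros s _; apply is_RC_derive_Cexp_param.
  - intros s Hs. rewrite Cmod_mult.
    apply Rmult_le_compat_l; [apply Cmod_ge_0 | apply HE; lra].
Qed.

Lemma Cmod_gauss_diff1_le (a b c : C) (u E t : R) :
  (forall s, 0 <= s <= 1 -> Cmod (Cexp ((1 + s) * quad a b c u)) <= E) ->
  0 < t <= 1 ->
  Cmod (gauss_diff1 a b c t u) <= 2 * (Cmod (quad a b c u) * E).
Proof.
  intros HE Ht. unfold gauss_diff1.
  rewrite Cmod_mult, Cmod_inv, Cmod_R, (Rabs_right t) by (try apply RtoC_neq_0; lra).
  apply Rmult_le_reg_l with t; [lra|].
  rewrite <- Rmult_assoc, Rinv_r, Rmult_1_l by lra.
  assert (H := Cmod_gauss_increment_le a b c u E t HE Ht). lra.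
Qed.

Lemma Cmod_gauss_diff2_le (a b c : C) (u E t : R) :
  (forall s, 0 <= s <= 1 -> Cmod (Cexp ((1 + s) * quad a b c u)) <= E) ->
  0 < t <= 1 ->
  Cmod (gauss_diff2 a b c t u)
  <= 4 * (Cmod (quad a b c u) * Cmod (quad a b c u) * E).
Proof.
  intros HE Ht. unfold gauss_diff2.
  set (q := Cmod (quad a b c u)).
  (* t^2 times the second difference is the increment over [0, t] of the
     exponential minus its tangent, whose s-derivative is itself an increment
     of size O(s). *)
  replace (gauss_diff1 a b c t u - quad a b c u * gauss a b c u)%C with
    (/ t * ((Cexp ((1 + t) * quad a b c u) + (- (quad a b c u * gauss a b c u)) * t)
      - (Cexp ((1 + 0) * quad a b c u) + (- (quad a b c u * gauss a b c u)) * 0)))%C.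
  2:{ unfold gauss_diff1. rewrite quad_dilation_0.
      fold (gauss a b c u). field. apply RtoC_neq_0; lra. }
  rewrite !Cmod_mult, !Cmod_inv, Cmod_R, (Rabs_right t) by (try apply RtoC_neq_0; lra).
  apply Rmult_le_reg_l with (t * t); [nra|].
  replace (t * t * (/ t * (/ t * _))) with
    (Cmod ((Cexp ((1 + t) * quad a b c u) + (- (quad a b c u * gauss a b c u)) * t)
      - (Cexp ((1 + 0) * quad a b c u) + (- (quad a b c u * gauss a b c u)) * 0)))
    by (field; lra).
  replace (t * t * (4 * (q * q * E))) with (2 * (2 * (q * q * E) * t) * t) by ring.
  apply (Cmod_mean_value
    (fun s => (Cexp ((1 + s) * quad a b c u) + (- (quad a b c u * gauss a b c u)) * s)%C)
    (fun s => (quad a b c u * Cexp ((1 + s) * quad a b c u)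
               + (- (quad a b c u * gauss a b c u)) * 1)%C)); [lra| |].
  - intros s _. apply is_RC_derive_plus; [apply is_RC_derive_Cexp_param|].
    apply is_RC_derive_scal, is_RC_derive_id.
  - intros s Hs.
    replace (_ + _)%C with
      (quad a b c u * (Cexp ((1 + s) * quad a b c u) - gauss a b c u))%C by ring.
    rewrite Cmod_mult. fold q.
    assert (Hq : 0 <= q) by apply Cmod_ge_0.
    assert (HE0 : 0 <= E) by (eapply Rle_trans; [apply Cmod_ge_0 | apply (HE 0); lra]).
    assert (Hqe : 0 <= q * E) by nra.
    replace (2 * (q * q * E) * t) with (q * (2 * (q * E) * t)) by ring.
    apply Rmult_le_compat_l; [exact Hq|].
    destruct (Rle_lt_or_eq_dec 0 s) as [H0|H0]; [lra| |].
    + eapply Rle_trans; [apply (Cmod_gauss_increment_le a b c u E s HE); lra|].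
      fold q. apply Rmult_le_compat_l; lra.
    + subst s. rewrite quad_dilation_0. fold (gauss a b c u).
      replace (gauss a b c u - gauss a b c u)%C with (RtoC 0) by ring.
      rewrite Cmod_0. apply Rmult_le_pos; lra.
Qed.

Lemma gaussian_bound_decay (G : R -> R -> C) (D M k : R) (i j : nat) :
  0 < k -> 0 <= D ->
  (forall t u, 0 < t <= 1 ->
     Cmod (G t u) <= D * ((1 + u * u) ^ i * exp (M - k * (u * u)))) ->
  exists B, forall t u, 0 < t <= 1 -> Rabs u ^ j * Cmod (G t u) <= B.
Proof.
  intros Hk HD HG.
  destruct (gaussian_decay (j + i) k Hk) as [B HB].
  exists (D * exp M * B). intros t u Ht.
  assert (Hu : Rabs u ^ j <= (1 + u * u) ^ j).
  { apply pow_incr. split; [apply Rabs_pos|].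
    assert (Rabs u * Rabs u = u * u) by (rewrite <- Rabs_mult; apply Rabs_right; nra).
    assert (H0 := Rabs_pos u). nra. }
  eapply Rle_trans.
  { apply Rmult_le_compat;
      [apply pow_le, Rabs_pos | apply Cmod_ge_0 | exact Hu | apply HG, Ht]. }
  replace ((1 + u * u) ^ j * (D * ((1 + u * u) ^ i * exp (M - k * (u * u))))) with
    (D * exp M * ((1 + u * u) ^ (j + i) * exp (- (k * (u * u))))).
  2:{ unfold Rminus. rewrite exp_plus, pow_add. ring. }
  apply Rmult_le_compat_l; [|apply HB].
  apply Rmult_le_pos; [exact HD | left; apply exp_pos].
Qed.

(** The uniformity in [t] is what makes the difference quotients converge.  Only
    the three generators need analysis; the factor [u] is absorbed by raising
    [j], and the factor [t] because it is at most 1. *)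
Lemma gauss_family_bounded (a b c : C) (F : R -> R -> C) (j : nat) :
  Re c < 0 -> gauss_family a b c F ->
  exists B, forall t u, 0 < t <= 1 -> Rabs u ^ j * Cmod (F t u) <= B.
Proof.
  intros Hc HF.
  destruct (Cmod_gauss_dilation_le a b c Hc) as [M [k [Hk HE]]].
  set (q1 := Cmod a + Cmod b + Cmod c).
  assert (Hq1 : 0 <= q1).
  { assert (Ha := Cmod_ge_0 a). assert (Hb := Cmod_ge_0 b).
    assert (Hc' := Cmod_ge_0 c). unfold q1; lra. }
  revert j; induction HF as
    [ | | | F G _ IF _ IG | l F _ IF | F _ IF | F _ IF ]; intros j.
  - apply (gaussian_bound_decay _ 1 M k 0%nat); [exact Hk | lra |]. intros t u _.
    assert (H := HE 0 u ltac:(lra)). rewrite quad_dilation_0 in H.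
    unfold gauss. simpl pow. lra.
  - apply (gaussian_bound_decay _ (2 * q1) M k 1%nat); [exact Hk | lra |]. intros t u Ht.
    eapply Rle_trans;
      [apply (Cmod_gauss_diff1_le a b c u _ t (fun s Hs => HE s u Hs) Ht)|].
    assert (H := Cmod_quad_le a b c u). fold q1 in H.
    assert (HEpos := exp_pos (M - k * (u * u))). simpl pow. nra.
  - apply (gaussian_bound_decay _ (4 * (q1 * q1)) M k 2%nat); [exact Hk | nra |].
    intros t u Ht.
    eapply Rle_trans;
      [apply (Cmod_gauss_diff2_le a b c u _ t (fun s Hs => HE s u Hs) Ht)|].
    assert (H := Cmod_quad_le a b c u). fold q1 in H.
    set (E := exp (M - k * (u * u))).
    replace (4 * (q1 * q1) * ((1 + u * u) ^ 2 * E)) with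
      (4 * ((q1 * (1 + u * u)) * (q1 * (1 + u * u)) * E)) by ring.
    apply Rmult_le_compat_l; [lra|].
    apply Rmult_le_compat_r; [left; apply exp_pos|].
    apply Rmult_le_compat; try apply Cmod_ge_0; assumption.
  - destruct (IF j) as [BF HBF], (IG j) as [BG HBG].
    exists (BF + BG). intros t u Ht.
    specialize (HBF t u Ht). specialize (HBG t u Ht).
    assert (H := Cmod_triangle (F t u) (G t u)).
    assert (H0 : 0 <= Rabs u ^ j) by (apply pow_le, Rabs_pos).
    nra.
  - destruct (IF j) as [BF HBF].
    exists (Cmod l * BF). intros t u Ht. specialize (HBF t u Ht).
    rewrite Cmod_mult. assert (H := Cmod_ge_0 l). nra.
  - destruct (IF j) as [BF HBF].
    exists BF. intros t u Ht. specialize (HBF t u Ht).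
    rewrite Cmod_mult, Cmod_R, (Rabs_right t) by lra.
    assert (H0 : 0 <= Rabs u ^ j * Cmod (F t u)).
    { apply Rmult_le_pos; [apply pow_le, Rabs_pos | apply Cmod_ge_0]. }
    nra.
  - destruct (IF (S j)) as [BF HBF].
    exists BF. intros t u Ht. specialize (HBF t u Ht).
    rewrite Cmod_mult, Cmod_R. simpl in HBF.
    eapply Rle_trans; [|exact HBF]. right; ring.
Qed.

(** * Convergence in the Schwartz space *)

Lemma bound_up_to (Q : nat -> R -> Prop) (N : nat) :
  (forall k B B', B <= B' -> Q k B -> Q k B') ->
  (forall k, exists B, Q k B) -> exists B, forall k, (k <= N)%nat -> Q k B.
Proof.
  intros mono H. induction N as [|N [B HB]].
  - destruct (H 0%nat) as [B HB]. exists B. intros k Hk.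
    replace k with 0%nat by lia. exact HB.
  - destruct (H (S N)) as [B' HB']. exists (Rmax B B'). intros k Hk.
    destruct (Nat.eq_dec k (S N)) as [->|Hne].
    + apply (mono _ B'); [apply Rmax_r | exact HB'].
    + apply (mono _ B); [apply Rmax_l | apply HB; lia].
Qed.

Lemma schwartz_seminorm_le (phi : R -> C) (j k : nat) (B : R) :
  (forall u, Rabs u ^ j * Cmod (RC_Derive_n phi k u) <= B) ->
  exists r, schwartz_seminorm j k phi = Finite r /\ r <= B.
Proof.
  intros H. unfold schwartz_seminorm.
  match goal with |- context [Lub_Rbar ?P] =>
    destruct (Lub_Rbar_correct P) as [Hub Hlub] end.
  assert (H1 := Hlub (Finite B) ltac:(intros s [u ->]; apply H)).
  assert (H2 := Hub _ (ex_intro _ 0 eq_refl)).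
  destruct (Lub_Rbar _) as [r| |]; [| elim H1 | elim H2].
  exists r; split; [reflexivity | exact H1].
Qed.

Lemma fam_derivative_bounded (a b c : C) (F : R -> R -> C) (j k : nat) :
  Re c < 0 -> gauss_family a b c F ->
  exists B, forall t u, 0 < t <= 1 ->
    Rabs u ^ j * Cmod (RC_Derive_n (F t) k u) <= B.
Proof.
  intros Hc HF.
  destruct (fam_Derive_n a b c F k HF) as [dF [HdF D]].
  destruct (gauss_family_bounded a b c dF j Hc HdF) as [B HB].
  exists B. intros t u Ht. destruct (D t ltac:(lra)) as [-> _]. apply HB, Ht.
Qed.

Lemma fam_schwartz (a b c : C) (F : R -> R -> C) (t : R) :
  Re c < 0 -> gauss_family a b c F -> 0 < t <= 1 -> schwartz (F t).
Proof.
  intros Hc HF Ht. split.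
  - intros k u. destruct (fam_Derive_n a b c F k HF) as [dF [_ D]].
    apply (D t); lra.
  - intros j k. destruct (fam_derivative_bounded a b c F j k Hc HF) as [B HB].
    destruct (schwartz_seminorm_le (F t) j k B (fun u => HB t u Ht)) as [r [-> _]].
    reflexivity.
Qed.

Lemma schwartz_gauss (a b c : C) : Re c < 0 -> schwartz (gauss a b c).
Proof.
  intros Hc.
  apply (fam_schwartz a b c (fun _ => gauss a b c) 1); [exact Hc | apply fam_gauss | lra].
Qed.

Lemma fam_quad_gauss (a b c : C) :
  gauss_family a b c (fun _ u => quad a b c u * gauss a b c u)%C.
Proof.
  assert (H := fam_gauss a b c).
  apply (fam_ext _ _ _ (fun t u => (a + b * u) * gauss a b c u
    + c * (RtoC u * (RtoC u * gauss a b c u)))%C).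
  - intros; unfold quad; ring.
  - apply fam_plus.
    + apply (fam_linear a b c a b (fun _ u => gauss a b c u)), H.
    + apply fam_scal, (fam_var _ _ _ (fun t u => RtoC u * gauss a b c u)%C),
        (fam_var _ _ _ (fun _ u => gauss a b c u)), H.
Qed.

Lemma schwartz_quad_gauss (a b c : C) : Re c < 0 ->
  schwartz (fun u => quad a b c u * gauss a b c u)%C.
Proof.
  intros Hc.
  apply (fam_schwartz a b c (fun _ u => quad a b c u * gauss a b c u)%C 1);
    [exact Hc | apply fam_quad_gauss | lra].
Qed.

Lemma tempered_eps (T : (R -> C) -> C) (phi : R -> C) (eps : R) :
  tempered_distribution T -> schwartz phi -> 0 < eps ->
  schwartz_nbhs phi (fun psi => Cmod (T psi - T phi) < eps).
Proof.
  intros [_ HT] Hphi Heps.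
  apply (HT phi Hphi (fun z => Cmod (z - T phi) < eps)).
  assert (He : 0 < eps / 2) by lra.
  exists (mkposreal _ He). intros z Hz.
  apply (C_NormedModule_mixin_compat2 (T phi) z (mkposreal _ He)) in Hz.
  eapply Rlt_le_trans; [exact Hz|]. simpl.
  assert (Hs2 := sqrt2_le_2).
  nra.
Qed.

Lemma RC_Derive_n_scal_real (phi : R -> C) (t : R) (k : nat) (u : R) :
  RC_Derive_n (fun u => t * phi u)%C k u = (t * RC_Derive_n phi k u)%C.
Proof.
  unfold RC_Derive_n.
  replace (fun s => Re (t * phi s)%C) with (fun s => t * Re (phi s))
    by (apply functional_extensionality; intros; unfold Re; simpl; ring).
  replace (fun s => Im (t * phi s)%C) with (fun s => t * Im (phi s))
    by (apply functional_extensionality; intros; unfold Im; simpl; ring).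
  rewrite !Derive_n_scal_l.
  apply injective_projections; simpl; ring.
Qed.

(** The first divided difference differs from its limit [quad * gauss] by
    [t * gauss_diff2], and the seminorms of [gauss_diff2] are bounded uniformly in
    [t]. *)
Lemma tempered_gauss_diff1 (T : (R -> C) -> C) (a b c : C) (eps : R) :
  tempered_distribution T -> Re c < 0 -> 0 < eps ->
  exists delta, 0 < delta /\ forall t, 0 < t < delta -> t <= 1 /\
    Cmod (T (gauss_diff1 a b c t) - T (fun u => quad a b c u * gauss a b c u))%C < eps.
Proof.
  intros HT Hc Heps.
  destruct (tempered_eps T _ eps HT (schwartz_quad_gauss a b c Hc) Heps)
    as [N [d Hd]].
  destruct (bound_up_to (fun j B => forall k, (k <= N)%nat ->
      forall t u, 0 < t <= 1 ->
        Rabs u ^ j * Cmod (RC_Derive_n (gauss_diff2 a b c t) k u) <= B) N)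
    as [B HB].
  { intros j B B' HBB H k Hk t u Ht. eapply Rle_trans; [apply H; assumption | exact HBB]. }
  { intros j. apply (bound_up_to (fun k B => forall t u, 0 < t <= 1 ->
        Rabs u ^ j * Cmod (RC_Derive_n (gauss_diff2 a b c t) k u) <= B)).
    - intros k B B' HBB H t u Ht. eapply Rle_trans; [apply H, Ht | exact HBB].
    - intros k. apply (fam_derivative_bounded a b c); [exact Hc | apply fam_diff2]. }
  assert (Hd0 := cond_pos d).
  assert (HB0 : 0 < Rabs B + 1) by (assert (H := Rabs_pos B); lra).
  exists (Rmin 1 (d / (Rabs B + 1))). split.
  { apply Rmin_pos; [lra | apply Rdiv_lt_0_compat; lra]. }
  intros t Ht.
  assert (H1 := Rmin_l 1 (d / (Rabs B + 1))).
  assert (H2 := Rmin_r 1 (d / (Rabs B + 1))).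
  split; [lra|].
  apply Hd.
  - apply (fam_schwartz a b c); [exact Hc | apply fam_diff1 | lra].
  - intros j k Hj Hk.
    replace (fun u => gauss_diff1 a b c t u - quad a b c u * gauss a b c u)%C
      with (fun u => t * gauss_diff2 a b c t u)%C.
    2:{ apply functional_extensionality; intros u. unfold gauss_diff2.
        field. apply RtoC_neq_0; lra. }
    destruct (schwartz_seminorm_le (fun u => t * gauss_diff2 a b c t u)%C j k (t * B))
      as [r [-> Hr]].
    { intros u. rewrite RC_Derive_n_scal_real, Cmod_mult, Cmod_R, (Rabs_right t) by lra.
      assert (H := HB j Hj k Hk t u ltac:(lra)).
      replace (_ * _) with
        (t * (Rabs u ^ j * Cmod (RC_Derive_n (gauss_diff2 a b c t) k u))) by ring.
      apply Rmult_le_compat_l; lra. }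
    simpl. eapply Rle_lt_trans; [exact Hr|].
    assert (t * (Rabs B + 1) < d).
    { apply Rlt_le_trans with (d / (Rabs B + 1) * (Rabs B + 1)).
      - apply Rmult_lt_compat_r; lra.
      - right; field; lra. }
    assert (HBa := Rle_abs B). nra.
Qed.

(** The right derivative at [t = 0] passes under the pairing. *)
Lemma tempered_gauss_dilation (T : (R -> C) -> C) (a b c : C) (eps : R) :
  tempered_distribution T -> Re c < 0 -> 0 < eps ->
  exists delta, 0 < delta /\ forall t, 0 < t < delta ->
    Cmod (T (fun u => Cexp ((1 + t) * quad a b c u)) - T (gauss a b c)
          - t * T (fun u => quad a b c u * gauss a b c u))%C <= t * eps.
Proof.
  intros HT Hc Heps.
  destruct (tempered_gauss_diff1 T a b c eps HT Hc Heps) as [d [Hd H]].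
  exists d; split; [exact Hd|]. intros t Ht.
  destruct (H t Ht) as [Ht1 HC].
  replace (fun u => Cexp ((1 + t) * quad a b c u))
    with (fun u => 1 * gauss a b c u + t * gauss_diff1 a b c t u)%C.
  2:{ apply functional_extensionality; intros u. unfold gauss_diff1.
      field. apply RtoC_neq_0; lra. }
  rewrite (proj1 HT); [| exact (schwartz_gauss a b c Hc) |].
  2:{ apply (fam_schwartz a b c (gauss_diff1 a b c) t); [exact Hc | apply fam_diff1 | lra]. }
  replace (_ - _ - _)%C with
    (t * (T (gauss_diff1 a b c t) - T (fun u => quad a b c u * gauss a b c u)))%C
    by ring.
  rewrite Cmod_mult, Cmod_R, Rabs_right by lra.
  apply Rmult_le_compat_l; lra.
Qed.

(** Vanishing discriminant makes the exponent [c] times a square, so that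
    [quad'^2 = 4 * c * quad] and the second derivative stays in the span of
    [gauss] and [quad * gauss]. *)
Lemma gauss_second_derivative (k a b c : C) : (b * b = 4 * a * c)%C ->
  RC_Derive_n (RC_Derive_n (fun u => k * gauss a b c u)%C 1) 1 =
  (fun u => 2 * c * k * gauss a b c u
            + 4 * c * k * (quad a b c u * gauss a b c u))%C.
Proof.
  intros Hd.
  replace (RC_Derive_n (fun u => k * gauss a b c u)%C 1)
    with (fun u : R => k * ((b + 2 * c * u) * gauss a b c u))%C.
  - apply functional_extensionality; intros u. apply RC_Derive_n_1.
    replace (_ + _)%C with
      (k * ((2 * c * 1) * gauss a b c u
        + (b + 2 * c * u) * ((b + 2 * c * u) * gauss a b c u)))%C.
    + apply is_RC_derive_scal, (is_RC_derive_mult (fun u : R => b + 2 * c * u)%C); [|apply is_RC_derive_gauss].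
      replace (2 * c * 1)%C with (0 + 2 * c * 1)%C by ring.
      apply is_RC_derive_plus; [apply is_RC_derive_const|].
      apply is_RC_derive_scal, is_RC_derive_id.
    + replace ((b + 2 * c * u) * ((b + 2 * c * u) * gauss a b c u))%C
        with ((b * b + 4 * c * (b * u + c * (u * u))) * gauss a b c u)%C by ring.
      rewrite Hd. unfold quad. ring.
  - apply functional_extensionality; intros u. symmetry. apply RC_Derive_n_1.
    apply is_RC_derive_scal, is_RC_derive_gauss.
Qed.

(** * Radial derivative of a holomorphic function *)

(** Complex differentiability in two variables, read as a first-order expansion
    with two scalar coefficients. *)
Lemma holomorphic_expansion (f2 : C -> C -> C) (z w : C) :
  holomorphic_on_C_H f2 -> 0 < Im w ->
  exists l m : C, forall eps, 0 < eps -> exists delta, 0 < delta /\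
    forall h k : C, Cmod h < delta -> Cmod k < delta ->
      Cmod (f2 (z + h) (w + k) - f2 z w - (h * l + k * m))%C
      <= eps * (Cmod h + Cmod k).
Proof.
  intros Hf Hw.
  destruct (Hf z w Hw) as [L [HL Hdom]].
  exists (L (RtoC 1, RtoC 0)), (L (RtoC 0, RtoC 1)). intros eps Heps.
  (* The norm of (h, k) is at most sqrt 2 times the larger modulus; half of eps
     absorbs this factor. *)
  specialize (Hdom (z, w) (fun P HP => HP)).
  assert (He : 0 < eps / 2) by lra.
  destruct (Hdom (mkposreal _ He)) as [d Hd].
  exists d; split; [apply cond_pos|]. intros h k Hh Hk.
  assert (Hball : ball (M := prod_UniformSpace C_UniformSpace C_UniformSpace)
    (z, w) d ((z + h)%C, (w + k)%C)).
  { split; apply C_NormedModule_mixin_compat1.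
    - change (Cmod ((z + h) - z)%C < d).
      replace ((z + h) - z)%C with h by ring. exact Hh.
    - change (Cmod ((w + k) - w)%C < d).
      replace ((w + k) - w)%C with k by ring. exact Hk. }
  specialize (Hd _ Hball).
  assert (E : minus (G := prod_NormedModule C_AbsRing C_NormedModule C_NormedModule)
     ((z + h)%C, (w + k)%C) (z, w) = (h, k)).
  { apply injective_projections.
    - change (((z + h) - z)%C = h). ring.
    - change (((w + k) - w)%C = k). ring. }
  rewrite E in Hd.
  assert (EL : L (h, k) = (h * L (RtoC 1, RtoC 0) + k * L (RtoC 0, RtoC 1))%C).
  { transitivity (plus (scal h (L (RtoC 1, RtoC 0))) (scal k (L (RtoC 0, RtoC 1))));
      [|reflexivity].
    rewrite <- !(linear_scal L HL), <- (linear_plus L HL). f_equal.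
    apply injective_projections.
    - change (h = (h * 1 + k * 0)%C). ring.
    - change (k = (h * 0 + k * 1)%C). ring. }
  rewrite EL in Hd. simpl fst in Hd. simpl snd in Hd.
  eapply Rle_trans; [exact Hd|]. simpl pos.
  destruct (norm_prod (U := C_NormedModule) (V := C_NormedModule) h k) as [_ Hn].
  change (norm (V := C_NormedModule) h) with (Cmod h) in Hn.
  change (norm (V := C_NormedModule) k) with (Cmod k) in Hn.
  assert (Hh0 := Cmod_ge_0 h). assert (Hk0 := Cmod_ge_0 k).
  assert (Rmax (Cmod h) (Cmod k) <= Cmod h + Cmod k) by (apply Rmax_lub; lra).
  assert (0 <= Rmax (Cmod h) (Cmod k)) by (eapply Rle_trans; [exact Hh0 | apply Rmax_l]).
  assert (Hs2 := sqrt2_le_2).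
  assert (0 <= sqrt 2) by apply sqrt_pos.
  replace (eps * (Cmod h + Cmod k)) with (eps / 2 * (2 * (Cmod h + Cmod k))) by field.
  apply Rmult_le_compat_l; [lra|].
  eapply Rle_trans; [exact Hn|]. nra.
Qed.

Lemma C_derive_expansion (g : C -> C) (z l : C) :
  (forall eps, 0 < eps -> exists delta, 0 < delta /\ forall h, Cmod h < delta ->
    Cmod (g (z + h) - g z - h * l)%C <= eps * Cmod h) ->
  C_derive g z = l.
Proof.
  intros H. apply is_C_derive_unique. split.
  - apply @is_linear_scal_l.
  - intros y Hy.
    apply (is_filter_lim_locally_unique (V := AbsRing_NormedModule C_AbsRing)) in Hy.
    subst y. intros eps.
    destruct (H eps (cond_pos eps)) as [d [Hd Hb]].
    assert (Hall : forall v : C, Cmod (v - z)%C < d ->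
      Cmod (g v - g z - (v - z) * l)%C <= eps * Cmod (v - z)%C).
    { intros v Hv. specialize (Hb (v - z)%C Hv).
      replace (z + (v - z))%C with v in Hb by ring. exact Hb. }
    exists (mkposreal d Hd). intros v Hv. exact (Hall v Hv).
Qed.

(** Joint differentiability in [(z, w)] is essential here: the dilation moves both
    variables at once. *)
Lemma holomorphic_radial (f2 : C -> C -> C) (z w : C) (eps : R) :
  holomorphic_on_C_H f2 -> 0 < Im w -> 0 < eps ->
  exists delta, 0 < delta /\ forall t : R, 0 < t < delta ->
    Cmod (f2 ((1 + t) * z) ((1 + t) * w) - f2 z w
      - t * (z * C_derive (fun z' => f2 z' w) z
             + w * C_derive (fun w' => f2 z w') w))%C <= t * eps.
Proof.
  intros Hf Hw Heps.
  destruct (holomorphic_expansion f2 z w Hf Hw) as [l [m H]].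
  replace (C_derive (fun z' => f2 z' w) z) with l.
  2:{ symmetry; apply C_derive_expansion. intros e He.
      destruct (H e He) as [d [Hd Hb]]. exists d; split; [exact Hd|].
      intros h Hh. specialize (Hb h 0 Hh ltac:(rewrite Cmod_0; exact Hd)).
      replace (w + 0)%C with w in Hb by ring.
      replace (h * l + 0 * m)%C with (h * l)%C in Hb by ring.
      rewrite Cmod_0, Rplus_0_r in Hb. exact Hb. }
  replace (C_derive (fun w' => f2 z w') w) with m.
  2:{ symmetry; apply C_derive_expansion. intros e He.
      destruct (H e He) as [d [Hd Hb]]. exists d; split; [exact Hd|].
      intros h Hh. specialize (Hb 0 h ltac:(rewrite Cmod_0; exact Hd) Hh).
      replace (z + 0)%C with z in Hb by ring.
      replace (0 * l + h * m)%C with (h * m)%C in Hb by ring.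
      rewrite Cmod_0, Rplus_0_l in Hb. exact Hb. }
  assert (Hz0 := Cmod_ge_0 z). assert (Hw0 := Cmod_ge_0 w).
  set (n := Cmod z + Cmod w + 1).
  assert (Hn : 0 < n) by (unfold n; lra).
  destruct (H (eps / n)) as [d [Hd Hb]]; [apply Rdiv_lt_0_compat; lra|].
  exists (d / n). split; [apply Rdiv_lt_0_compat; lra|].
  intros t Ht.
  assert (Htn : t * n < d).
  { apply Rlt_le_trans with (d / n * n); [apply Rmult_lt_compat_r; lra|].
    right; field; lra. }
  assert (Cz : Cmod (t * z)%C = t * Cmod z)
    by (rewrite Cmod_mult, Cmod_R, Rabs_right; lra).
  assert (Cw : Cmod (t * w)%C = t * Cmod w)
    by (rewrite Cmod_mult, Cmod_R, Rabs_right; lra).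
  specialize (Hb (t * z)%C (t * w)%C). rewrite Cz, Cw in Hb.
  replace ((1 + t) * z)%C with (z + t * z)%C by ring.
  replace ((1 + t) * w)%C with (w + t * w)%C by ring.
  replace (t * (z * l + w * m))%C with (t * z * l + t * w * m)%C by ring.
  eapply Rle_trans; [apply Hb; unfold n in Htn; nra|].
  apply Rle_trans with (eps / n * (t * n)).
  - apply Rmult_le_compat_l; [left; apply Rdiv_lt_0_compat; lra | unfold n; nra].
  - right; field; lra.
Qed.

(** * The metamorphism kernel as a Gaussian *)

Lemma metamorphism_weight_nonzero (b r : R) : 0 < r -> (r ^ 2 - Ci * b)%C <> 0.
Proof.
  intros Hr He. apply (f_equal Re) in He. unfold Re in He; simpl in He. nra.
Qed.

(** The exponent of the factor by which [G_map] multiplies [f2]. *)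
Definition kernel_shift (hbar x b r : R) : C :=
  (- (PI * hbar * x ^ 2) / (r ^ 2 - Ci * b))%C.

Definition kernel_coef2 (hbar b r : R) : C :=
  (- (PI * hbar) * (r ^ 2 - Ci * b))%C.

Definition kernel_coef1 (hbar x y b r : R) : C :=
  (- (PI * hbar) * (2 * Ci * x - 2 * (r ^ 2 - Ci * b) * y))%C.

(** Chosen so that the quadratic exponent has discriminant zero. *)
Definition kernel_coef0 (hbar x y b r : R) : C :=
  (kernel_coef1 hbar x y b r * kernel_coef1 hbar x y b r
   / (4 * kernel_coef2 hbar b r))%C.

Definition kernel_quad (hbar x y b r : R) : R -> C :=
  quad (kernel_coef0 hbar x y b r) (kernel_coef1 hbar x y b r)
       (kernel_coef2 hbar b r).

Lemma Re_kernel_coef2_neg (hbar b r : R) :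
  0 < hbar -> 0 < r -> Re (kernel_coef2 hbar b r) < 0.
Proof.
  intros Hh Hr.
  replace (Re (kernel_coef2 hbar b r)) with (- (PI * hbar * (r * r)))
    by (unfold kernel_coef2, Re; simpl; ring).
  assert (H := PI_RGT_0).
  assert (0 < PI * hbar * (r * r)) by (apply Rmult_lt_0_compat; nra).
  lra.
Qed.

Lemma kernel_coef2_nonzero (hbar b r : R) :
  0 < hbar -> 0 < r -> kernel_coef2 hbar b r <> 0%C.
Proof.
  intros Hh Hr He. assert (H := Re_kernel_coef2_neg hbar b r Hh Hr).
  rewrite He in H. simpl in H. lra.
Qed.

Lemma Ci_sqr : (Ci * Ci)%C = (- (1))%C.
Proof. apply injective_projections; simpl; ring. Qed.

(** Splitting off [kernel_shift] is completing the square in [u - y]. *)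
Lemma kernel_exponent (hbar x y b r u : R) : 0 < hbar -> 0 < r ->
  (- (PI * hbar) *
     ((r ^ 2 - Ci * b) * (u - y) ^ 2 + 2 * Ci * (u - y) * x))%C
  = (kernel_shift hbar x b r + kernel_quad hbar x y b r u)%C.
Proof.
  intros Hh Hr. unfold kernel_quad, quad, kernel_coef0, kernel_shift,
    kernel_coef1, kernel_coef2.
  assert (HP := metamorphism_weight_nonzero b r Hr).
  set (P := (r ^ 2 - Ci * b)%C) in *.
  assert (Hpi : (PI * hbar)%C <> 0).
  { rewrite <- RtoC_mult. apply RtoC_neq_0.
    apply Rgt_not_eq, Rmult_lt_0_compat; [apply PI_RGT_0 | exact Hh]. }
  set (p := (PI * hbar)%C) in *.
  replace (- p * (2 * Ci * x - 2 * P * y) * (- p * (2 * Ci * x - 2 * P * y)))%C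
    with (4 * (p * p * ((Ci * Ci) * (x * x) - 2 * Ci * x * P * y + P * P * y * y)))%C by ring.
  rewrite Ci_sqr.
  field. split; assumption.
Qed.

(** Both parts of the exponent are homogeneous of degree one in [(x, b, r^2)], so
    dilating [x] and [b] by [1 + t] and [r] by its square root multiplies the
    exponent by [1 + t]; at the same time [z] and [w] are dilated by [1 + t]. *)
Lemma kernel_dilation (hbar x y b r t : R) : 0 < hbar -> 0 < r -> 0 <= t ->
  metamorphism_kernel hbar ((1 + t) * x) y ((1 + t) * b) (sqrt (1 + t) * r)
  = (fun u => Cexp ((1 + t) * kernel_shift hbar x b r)
              * Cexp ((1 + t) * kernel_quad hbar x y b r u))%C.
Proof.
  intros Hh Hr Ht. apply functional_extensionality; intros u.
  rewrite <- Cexp_plus, <- Cmult_plus_distr_l, <- (kernel_exponent hbar x y b r u Hh Hr).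
  unfold metamorphism_kernel. f_equal.
  replace (RtoC (sqrt (1 + t) * r) ^ 2)%C with ((1 + t) * r ^ 2)%C.
  - rewrite !RtoC_mult, RtoC_plus. ring.
  - rewrite <- !RtoC_pow, Rpow_mult_distr, pow2_sqrt, RtoC_mult, RtoC_plus by lra.
    reflexivity.
Qed.

(** * The holomorphic function as a pairing *)

Lemma tempered_scal (T : (R -> C) -> C) (k : C) (phi : R -> C) :
  tempered_distribution T -> schwartz phi ->
  T (fun u => k * phi u)%C = (k * T phi)%C.
Proof.
  intros [HT _] Hphi.
  transitivity (k * T phi + 0 * T phi)%C; [|ring].
  rewrite <- HT by assumption.
  f_equal. apply functional_extensionality; intros u; ring.
Qed.

Lemma Cexp_nonzero (z : C) : Cexp z <> 0%C.
Proof.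
  intros He. assert (H := Cmod_Cexp z). rewrite He, Cmod_0 in H.
  assert (H1 := exp_pos (Re z)). lra.
Qed.

Lemma schwartz_gauss_dilation (a b c : C) (t : R) : Re c < 0 -> 0 <= t ->
  schwartz (fun u => Cexp ((1 + t) * quad a b c u))%C.
Proof.
  intros Hc Ht.
  replace (fun u => Cexp ((1 + t) * quad a b c u))%C
    with (gauss ((1 + t) * a) ((1 + t) * b) ((1 + t) * c))%C.
  - apply schwartz_gauss.
    replace (Re ((1 + t) * c)%C) with ((1 + t) * Re c)
      by (unfold Re, Im; simpl; ring).
    nra.
  - apply functional_extensionality; intros u. unfold gauss. f_equal.
    unfold quad. ring.
Qed.

(** In [metamorphism hbar f = G_map hbar f2] at the dilated point, the factors
    [sqrt r] and [Cexp kernel_shift] are common to both sides and cancel. *)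
Lemma holomorphic_part_pairing (hbar : R) (f : (R -> C) -> C) (f2 : C -> C -> C)
  (x y b r t : R) :
  0 < hbar -> tempered_distribution f ->
  (forall x y b r : R, 0 < r ->
     metamorphism hbar f x y b r = G_map hbar f2 x y b r) ->
  0 < r -> 0 <= t ->
  f2 ((1 + t) * (x + (b + Ci * r ^ 2) * y))%C ((1 + t) * (b + Ci * r ^ 2))%C
  = (sqrt hbar * f (fun u => Cexp ((1 + t) * kernel_quad hbar x y b r u)))%C.
Proof.
  intros Hh Hf HM Hr Ht.
  assert (Hs : 0 < sqrt (1 + t) * r)
    by (apply Rmult_lt_0_compat; [apply sqrt_lt_R0; lra | exact Hr]).
  assert (H := HM ((1 + t) * x) y ((1 + t) * b) (sqrt (1 + t) * r) Hs).
  unfold metamorphism, G_map in H.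
  rewrite kernel_dilation in H by assumption.
  rewrite tempered_scal in H;
    [| exact Hf | apply schwartz_gauss_dilation;
                  [apply Re_kernel_coef2_neg; assumption | exact Ht]].
  assert (HP := metamorphism_weight_nonzero b r Hr).
  assert (Ht1 : (1 + t)%C <> 0)
    by (rewrite <- RtoC_plus; apply RtoC_neq_0; lra).
  assert (Er : (RtoC (sqrt (1 + t) * r) ^ 2)%C = ((1 + t) * r ^ 2)%C).
  { rewrite <- !RtoC_pow, Rpow_mult_distr, pow2_sqrt, RtoC_mult, RtoC_plus by lra.
    reflexivity. }
  rewrite Er, sqrt_mult_alt in H by lra.
  rewrite !RtoC_mult, RtoC_plus in H.
  replace (- (PI * hbar * ((1 + t) * x) ^ 2) / ((1 + t) * r ^ 2 - Ci * ((1 + t) * b)))%C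
    with ((1 + t) * kernel_shift hbar x b r)%C in H
    by (unfold kernel_shift; field; split;
        [replace (_ - _)%C with ((1 + t) * (r ^ 2 - Ci * b))%C by ring;
         apply Cmult_neq_0; assumption | exact HP]).
  replace ((1 + t) * (x + (b + Ci * r ^ 2) * y))%C
    with ((1 + t) * x + ((1 + t) * b + Ci * ((1 + t) * r ^ 2)) * y)%C by ring.
  replace ((1 + t) * (b + Ci * r ^ 2))%C
    with ((1 + t) * b + Ci * ((1 + t) * r ^ 2))%C by ring.
  assert (Hk := Cexp_nonzero ((1 + t) * kernel_shift hbar x b r)%C).
  assert (Hr' : RtoC (sqrt (sqrt (1 + t) * r)) <> 0)
    by (apply RtoC_neq_0, Rgt_not_eq, sqrt_lt_R0, Hs).
  set (K := Cexp _) in *. set (S1 := RtoC (sqrt (sqrt _ * _))) in *.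
  set (V := f2 _ _) in *. set (W := f _) in *.
  transitivity (/ (S1 * K) * (S1 * K * V))%C; [field; split; assumption|].
  rewrite <- H. field. split; assumption.
Qed.

Lemma eq_of_Cmod_le (z w : C) :
  (forall eps, 0 < eps -> Cmod (z - w)%C <= eps) -> z = w.
Proof.
  intros H. assert (H0 : (z - w)%C = 0).
  { apply Cmod_eq_0, Rle_antisym; [|apply Cmod_ge_0].
    apply le_epsilon. intros eps Heps. rewrite Rplus_0_l. apply H, Heps. }
  replace z with ((z - w) + w)%C by ring. rewrite H0. ring.
Qed.

(** Both sides are the derivative at [t = 0] of [f2] along the dilation, computed
    from the holomorphy of [f2] and from the continuity of [f]. *)
Lemma holomorphic_part_radial (hbar : R) (f : (R -> C) -> C) (f2 : C -> C -> C)
  (x y b r : R) :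
  0 < hbar -> tempered_distribution f -> holomorphic_on_C_H f2 ->
  (forall x y b r : R, 0 < r ->
     metamorphism hbar f x y b r = G_map hbar f2 x y b r) ->
  0 < r ->
  let w := (b + Ci * r ^ 2)%C in
  let z := (x + w * y)%C in
  (z * C_derive (fun z' => f2 z' w) z + w * C_derive (fun w' => f2 z w') w)%C
  = (sqrt hbar * f (fun u => kernel_quad hbar x y b r u
                             * Cexp (kernel_quad hbar x y b r u)))%C.
Proof.
  intros Hh Hf Hol HM Hr w z.
  assert (Hw : 0 < Im w) by (unfold w, Im; simpl; nra).
  assert (Hc := Re_kernel_coef2_neg hbar b r Hh Hr).
  assert (Hsq : 0 < sqrt hbar) by (apply sqrt_lt_R0, Hh).
  apply eq_of_Cmod_le. intros eps Heps.
  assert (He2 : 0 < eps / 2) by lra.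
  assert (He3 : 0 < eps / 2 / sqrt hbar) by (apply Rdiv_lt_0_compat; lra).
  destruct (holomorphic_radial f2 z w (eps / 2) Hol Hw He2) as [d1 [Hd1 H1]].
  destruct (tempered_gauss_dilation f (kernel_coef0 hbar x y b r)
    (kernel_coef1 hbar x y b r) (kernel_coef2 hbar b r)
    (eps / 2 / sqrt hbar) Hf Hc He3) as [d2 [Hd2 H2]].
  assert (Hm1 := Rmin_l d1 d2). assert (Hm2 := Rmin_r d1 d2).
  assert (Hm : 0 < Rmin d1 d2) by (apply Rmin_pos; assumption).
  set (t := Rmin d1 d2 / 2).
  assert (Ht : 0 < t) by (unfold t; lra).
  specialize (H1 t ltac:(unfold t in *; lra)).
  specialize (H2 t ltac:(unfold t in *; lra)).
  assert (E1 := holomorphic_part_pairing hbar f f2 x y b r t Hh Hf HM Hr ltac:(lra)).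
  assert (E0 := holomorphic_part_pairing hbar f f2 x y b r 0 Hh Hf HM Hr ltac:(lra)).
  fold w in E0, E1. fold z in E0, E1.
  replace ((1 + 0) * z)%C with z in E0 by ring.
  replace ((1 + 0) * w)%C with w in E0 by ring.
  replace (fun u => Cexp ((1 + 0) * kernel_quad hbar x y b r u))%C
    with (fun u => Cexp (kernel_quad hbar x y b r u)) in E0
    by (apply functional_extensionality; intros u; f_equal; ring).
  rewrite E1, E0 in H1.
  change (gauss (kernel_coef0 hbar x y b r) (kernel_coef1 hbar x y b r)
    (kernel_coef2 hbar b r)) with (fun u => Cexp (kernel_quad hbar x y b r u)) in H2.
  change (quad (kernel_coef0 hbar x y b r) (kernel_coef1 hbar x y b r)
    (kernel_coef2 hbar b r)) with (kernel_quad hbar x y b r) in H2.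
  set (D := (z * _ + w * _)%C) in *.
  set (F1 := f (fun u => Cexp ((1 + t) * _))%C) in *.
  set (F0 := f (fun u => Cexp (kernel_quad _ _ _ _ _ u))) in *.
  set (FA := f (fun u => kernel_quad _ _ _ _ _ u * _)%C) in *.
  assert (H3 : Cmod (t * (D - sqrt hbar * FA))%C <= t * eps).
  { replace (t * (D - sqrt hbar * FA))%C with
      (sqrt hbar * (F1 - F0 - t * FA) + - (sqrt hbar * F1 - sqrt hbar * F0 - t * D))%C
      by ring.
    eapply Rle_trans; [apply Cmod_triangle|].
    rewrite Cmod_opp, Cmod_mult, Cmod_R, (Rabs_right (sqrt hbar)) by lra.
    assert (H4 : sqrt hbar * Cmod (F1 - F0 - t * FA)%C
      <= sqrt hbar * (t * (eps / 2 / sqrt hbar)))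
      by (apply Rmult_le_compat_l; [lra | exact H2]).
    replace (sqrt hbar * (t * (eps / 2 / sqrt hbar))) with (t * (eps / 2)) in H4
      by (field; lra).
    lra. }
  rewrite Cmod_mult, Cmod_R, (Rabs_right t) in H3 by lra.
  apply Rmult_le_reg_l in H3; assumption.
Qed.

Theorem proposition5 (hbar : R) (hbar_pos : 0 < hbar)
  (f : (R -> C) -> C) (f_tempered : tempered_distribution f)
  (f2 : C -> C -> C) (f2_holo : holomorphic_on_C_H f2)
  (Mf_eq : forall x y b r : R, 0 < r ->
     metamorphism hbar f x y b r = G_map hbar f2 x y b r) :
  forall x y b r : R, 0 < r ->
    metamorphism hbar (distr_derive (distr_derive f)) x y b r
    = G_map hbar (D_op hbar f2) x y b r.
Proof.
  intros x y b r Hr.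
  assert (Hc := Re_kernel_coef2_neg hbar b r hbar_pos Hr).
  assert (Rad := holomorphic_part_radial hbar f f2 x y b r
    hbar_pos f_tempered f2_holo Mf_eq Hr).
  assert (Val := holomorphic_part_pairing hbar f f2 x y b r 0
    hbar_pos f_tempered Mf_eq Hr (Rle_refl 0)).
  assert (K := kernel_dilation hbar x y b r 0 hbar_pos Hr (Rle_refl 0)).
  rewrite Rplus_0_r, sqrt_1, !Rmult_1_l in K.
  replace (fun u => Cexp ((1 + 0) * kernel_shift hbar x b r)
                    * Cexp ((1 + 0) * kernel_quad hbar x y b r u))%C
    with (fun u => Cexp (kernel_shift hbar x b r)
          * gauss (kernel_coef0 hbar x y b r) (kernel_coef1 hbar x y b r)
                  (kernel_coef2 hbar b r) u)%C in K.
  2:{ apply functional_extensionality; intros u. unfold gauss, kernel_quad.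
      f_equal; f_equal; ring. }
  unfold metamorphism, distr_derive, G_map, D_op.
  rewrite K, gauss_second_derivative.
  2:{ unfold kernel_coef0. field. apply kernel_coef2_nonzero; assumption. }
  rewrite (proj1 f_tempered);
    [| exact (schwartz_gauss _ _ _ Hc) | exact (schwartz_quad_gauss _ _ _ Hc)].
  cbv zeta in Rad.
  set (w := (b + Ci * r ^ 2)%C) in *. set (z := (x + w * y)%C) in *.
  replace ((1 + 0) * z)%C with z in Val by ring.
  replace ((1 + 0) * w)%C with w in Val by ring.
  replace (fun u => Cexp ((1 + 0) * kernel_quad hbar x y b r u))%C
    with (gauss (kernel_coef0 hbar x y b r) (kernel_coef1 hbar x y b r)
                (kernel_coef2 hbar b r)) in Val
    by (apply functional_extensionality; intros u; unfold gauss, kernel_quad;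
        f_equal; ring).
  change (fun u => kernel_quad hbar x y b r u * Cexp (kernel_quad hbar x y b r u))%C
    with (fun u => quad (kernel_coef0 hbar x y b r) (kernel_coef1 hbar x y b r)
       (kernel_coef2 hbar b r) u * gauss (kernel_coef0 hbar x y b r)
       (kernel_coef1 hbar x y b r) (kernel_coef2 hbar b r) u)%C in Rad.
  replace (2 * z * C_derive (fun z' => f2 z' w) z
     + 2 * w * C_derive (fun w' => f2 z w') w + f2 z w)%C
    with (2 * (z * C_derive (fun z' => f2 z' w) z
       + w * C_derive (fun w' => f2 z w') w) + f2 z w)%C by ring.
  rewrite Rad, Val, sqrt_mult_alt by lra. rewrite RtoC_mult.
  fold (kernel_shift hbar x b r).
  set (F0 := f (gauss _ _ _)). set (FA := f (fun u => _ * _)%C).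
  (* The leading coefficient is [PI * Ci * hbar * w], because r^2 - i b = - i w. *)
  assert (Ec : kernel_coef2 hbar b r = (PI * Ci * hbar * w)%C).
  { unfold kernel_coef2, w.
    transitivity (PI * hbar * (Ci * b + (- (1)) * r ^ 2))%C; [ring|].
    rewrite <- Ci_sqr. ring. }
  rewrite Ec. ring.
Qed.
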